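(* Let $1\to H\xrightarrow{f}G\xrightarrow{g}G/H\to1$ be a short exact sequence of groups, let $\|\cdot\|_G$ and $\|\cdot\|_{G/H}$ be conjugation invariant word norms on $G$ and $G/H$, each generated by finitely many conjugacy classes, and let $\|\cdot\|_H$ be a conjugation invariant norm on $H$. Let $\omega$ be a non-principal ultrafilter on $\mathbb{N}$. If $f:(H,\|\cdot\|_H)\to(G,\|\cdot\|_G)$ is a quasi-isometric embedding, then there is the following short exact sequence on the level of asymptotic cones: $$1\to \mathrm{Cone}_\omega(H,\|\cdot\|_H)\xrightarrow{\widehat f}\mathrm{Cone}_\omega(G,\|\cdot\|_G)\xrightarrow{\widehat g}\mathrm{Cone}_\omega(G/H,\|\cdot\|_{G/H})\to1,$$ where $\widehat f([x_n])=[f(x_n)]$ and $\widehat g([x_n])=[g(x_n)]$.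
   Context: A norm on a group $G$ is $\nu:G\to[0,\infty)$ with $\nu(g)=0$ iff $g=1$, $\nu(gh)\le\nu(g)+\nu(h)$ and $\nu(g^{-1})=\nu(g)$; it is conjugation invariant if $\nu(hgh^{-1})=\nu(g)$. It induces the metric $d(g,h)=\nu(gh^{-1})$. A word norm generated by finitely many conjugacy classes is a word norm $g\mapsto\min\{k\ge0\mid g=s_1\cdots s_k,\ s_i\in T\}$ where $T=T^{-1}$ is a generating set which is a union of finitely many conjugacy classes. A map $f:(X,d)\to(X',d')$ is a quasi-isometric embedding if there are $A\ge1$, $B\ge0$ with $\frac1Ad(x,y)-B\le d'(f(x),f(y))\le Ad(x,y)+B$ for all $x,y$. Asymptotic cone (scaling sequence $s_n=n$): a sequence $(x_n)_{n\ge1}$ in $G$ is admissible if $\|x_n\|/n$ is bounded; $\mathrm{Cone}_\omega(G,\|\cdot\|)$ is the set of admissible sequences modulo $(x_n)\sim(y_n)$ iff $\lim_\omega d(x_n,y_n)/n=0$, with metric $\lim_\omega d(x_n,y_n)/n$. For a conjugation invariant norm it is a (topological) group under termwise multiplication. *)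

(* Defs.v *)
From HB Require Import structures.
From mathcomp Require Import all_boot all_order all_algebra lra.
From mathcomp Require Import all_classical all_reals all_analysis.

Set Implicit Arguments.
Unset Strict Implicit.
Unset Printing Implicit Defensive.

Import Order.TTheory GRing.Theory Num.Theory.
Import numFieldNormedType.Exports.

Local Open Scope classical_set_scope.
Local Open Scope ring_scope.
Local Open Scope quotient_scope.

Record is_norm (R : realType) (G : groupType) (nu : G -> R) : Prop := IsNorm {
  gnorm_ge0 : forall g, 0 <= nu g;
  gnorm_eq0 : forall g, nu g = 0 <-> g = 1%g;
  gnormM : forall g h, nu (g * h)%g <= nu g + nu h;
  gnormV : forall g, nu g^-1%g = nu g }.

Definition conj_invariant (R : realType) (G : groupType) (nu : G -> R) : Prop :=
  forall g h, nu (h * g * h^-1)%g = nu g.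

Record conj_norm (R : realType) (G : groupType) := ConjNorm {
  conj_norm_fun :> G -> R;
  conj_normP : is_norm conj_norm_fun;
  conj_normJ : conj_invariant conj_norm_fun }.

Definition norm_dist (R : realType) (G : groupType) (nu : G -> R) (g h : G) : R :=
  nu (g * h^-1)%g.

Definition generates (G : groupType) (T : set G) : Prop :=
  forall K : set G, K 1%g -> (forall x y, K x -> K y -> K (x * y)%g) ->
    (forall x, K x -> K x^-1%g) -> T `<=` K -> K = setT.

Definition word_lengths (G : groupType) (T : set G) (g : G) : set nat :=
  [set k | exists s : seq G,
    [/\ size s = k, forall x, x \in s -> T x & g = (\prod_(x <- s) x)%g]].

Definition is_word_norm (R : realType) (G : groupType) (T : set G)
    (nu : G -> R) : Prop :=
  forall g, exists k : nat,
    [/\ nu g = k%:R, word_lengths T g k & lbound (word_lengths T g) k].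

Definition conj_class (G : groupType) (a : G) : set G :=
  [set (h * a * h^-1)%g | h in [set: G]].

Definition fin_conj_word_norm (R : realType) (G : groupType) (nu : G -> R) : Prop :=
  exists T : set G,
    [/\ exists2 A : set G, finite_set A & T = \bigcup_(a in A) conj_class a,
        [set x^-1%g | x in T] = T, generates T & is_word_norm T nu].

Definition quasi_isometric_embedding (R : realType) (X X' : Type)
    (d : X -> X -> R) (d' : X' -> X' -> R) (f : X -> X') : Prop :=
  exists A B : R, [/\ 1 <= A, 0 <= B & forall x y,
    A^-1 * d x y - B <= d' (f x) (f y) /\ d' (f x) (f y) <= A * d x y + B].

Definition short_exact (H G Q : groupType) (f : H -> G) (g : G -> Q) : Prop :=
  [/\ injective f, range f = [set x | g x = 1%g] & range g = setT].

Definition nonprincipal (omega : set_system nat) : Prop :=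
  forall k, omega <> principal_filter k.

(* Sequences are indexed by n >= 1; the entry at index 0 is a dummy. It is
   invisible to a non-principal ultrafilter (and r / 0 = 0 in the library). *)
Definition admissible (R : realType) (G : groupType) (nu : G -> R)
    (x : nat -> G) : Prop :=
  exists C : R, forall n, (0 < n)%N -> nu (x n) / n%:R <= C.

Record adm_seq (R : realType) (G : groupType) (nu : conj_norm R G) := AdmSeq {
  adm_fun :> nat -> G;
  adm_funP : admissible nu adm_fun }.

HB.instance Definition _ (R : realType) (G : groupType) (nu : conj_norm R G) :=
  gen_eqMixin (adm_seq nu).
HB.instance Definition _ (R : realType) (G : groupType) (nu : conj_norm R G) :=
  gen_choiceMixin (adm_seq nu).

Section NormFacts.
Variables (R : realType) (G : groupType) (nu : conj_norm R G).
Implicit Types (g h : G) (x y : nat -> G).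
Let nuP := conj_normP nu.

Lemma gnorm1 : nu 1%g = 0. Proof. exact/(gnorm_eq0 nuP). Qed.

Lemma norm_dist_ge0 g h : 0 <= norm_dist nu g h.
Proof. exact: (gnorm_ge0 nuP). Qed.

Lemma norm_distxx g : norm_dist nu g g = 0.
Proof. by rewrite /norm_dist mulgV gnorm1. Qed.

Lemma norm_dist_sym g h : norm_dist nu g h = norm_dist nu h g.
Proof. by rewrite /norm_dist -(gnormV nuP) invgM invgK. Qed.

Lemma norm_dist_triangle h g k :
  norm_dist nu g k <= norm_dist nu g h + norm_dist nu h k.
Proof.
have -> : norm_dist nu g k = nu ((g * h^-1) * (h * k^-1))%g.
  by rewrite /norm_dist mulgA mulgVK.
exact: (gnormM nuP).
Qed.

Lemma norm_distM g g' h h' :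
  norm_dist nu (g * h)%g (g' * h')%g <= norm_dist nu g g' + norm_dist nu h h'.
Proof.
have -> : norm_dist nu (g * h)%g (g' * h')%g =
    nu ((g * (h * h'^-1) * g^-1) * (g * g'^-1))%g.
  by rewrite /norm_dist invgM !mulgA mulgVK.
by rewrite (le_trans (gnormM nuP _ _))// (conj_normJ nu) addrC.
Qed.

Lemma norm_distV g h : norm_dist nu g^-1%g h^-1%g = norm_dist nu g h.
Proof.
have := conj_normJ nu (g^-1 * h)%g h.
by rewrite /norm_dist invgK !mulgA mulgK -(gnormV nuP (g * _)%g) invgM invgK => <-.
Qed.

Lemma admissible1 : admissible nu (fun=> 1%g).
Proof. by exists 0 => n _; rewrite gnorm1 mul0r. Qed.

Lemma admissibleM x y : admissible nu x -> admissible nu y ->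
  admissible nu (fun n => x n * y n)%g.
Proof.
move=> [C xC] [D yD]; exists (C + D) => n n0.
rewrite (le_trans _ (lerD (xC n n0) (yD n n0)))// -mulrDl.
by rewrite ler_wpM2r ?invr_ge0 ?ler0n// (gnormM nuP).
Qed.

Lemma admissibleV x : admissible nu x -> admissible nu (fun n => (x n)^-1)%g.
Proof. by move=> [C xC]; exists C => n n0; rewrite (gnormV nuP) xC. Qed.

End NormFacts.

Section Cone.
Variables (R : realType) (G : groupType) (nu : conj_norm R G).
Variables (omega : set_system nat) (omegaU : UltraFilter omega).
Implicit Types x y z : adm_seq nu.

Definition scaled_dist x y (n : nat) : R := norm_dist nu (x n) (y n) / n%:R.

Definition cone_rel x y : bool := `[< scaled_dist x y @ omega --> (0 : R) >].

Lemma scaled_dist_ge0 x y n : 0 <= scaled_dist x y n.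
Proof. by rewrite divr_ge0 ?norm_dist_ge0. Qed.

Lemma scaled_dist_sym x y : scaled_dist x y = scaled_dist y x.
Proof. by apply/funext => n; rewrite /scaled_dist norm_dist_sym. Qed.

Lemma scaled_dist_triangle y x z n :
  scaled_dist x z n <= scaled_dist x y n + scaled_dist y z n.
Proof.
rewrite -mulrDl ler_wpM2r ?invr_ge0 ?ler0n//.
exact: norm_dist_triangle.
Qed.

Lemma scaled_dist_bounded x y : exists C : R, forall n, scaled_dist x y n <= C.
Proof.
have [C xyC] := admissibleM (adm_funP x) (admissibleV (adm_funP y)).
exists (Num.max 0 C) => -[|n].
  by rewrite /scaled_dist invr0 mulr0 le_max lexx.
by rewrite le_max; apply/orP; right; exact: xyC.
Qed.

Lemma scaled_dist_cvg x y : cvg (scaled_dist x y @ omega).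
Proof.
have [C xyC] := scaled_dist_bounded x y.
have cK := @segment_compact R 0 C.
have F01 : (scaled_dist x y @ omega) [set` `[0, C]].
  apply: (@filterE _ omega) => n; rewrite /= in_itv/=; apply/andP; split.
    exact: scaled_dist_ge0.
  exact: xyC.
have [l [_ cl]] := cK _ _ F01.
apply/cvg_ex; exists l => A Al.
have [//|nA] := in_ultra_setVsetC (scaled_dist x y @^-1` A) omegaU.
by have [z [nAz Az]] := cl (~` A) A nA Al.
Qed.

Lemma cone_rel_squeeze x y (u : nat -> R) :
  (forall n, scaled_dist x y n <= u n) -> u @ omega --> (0 : R) -> cone_rel x y.
Proof.
move=> xyu u0; apply/asboolP.
apply: (squeeze_cvgr _ (cvg_cst (0 : R)) u0).
by apply: nearW => n; rewrite scaled_dist_ge0 xyu.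
Qed.

Lemma cone_rel_refl : reflexive cone_rel.
Proof.
move=> x; apply: (@cone_rel_squeeze _ _ (fun=> 0)); last exact: cvg_cst.
by move=> n; rewrite /scaled_dist norm_distxx mul0r.
Qed.

Lemma cone_rel_sym : symmetric cone_rel.
Proof. by move=> x y; rewrite /cone_rel scaled_dist_sym. Qed.

Lemma cone_rel_trans : transitive cone_rel.
Proof.
move=> y x z /asboolP xy /asboolP yz.
apply: (@cone_rel_squeeze _ _ (scaled_dist x y \+ scaled_dist y z)).
  exact: scaled_dist_triangle.
by rewrite -[0 in X in _ --> X](addr0 0); exact: cvgD.
Qed.

Canonical cone_equiv :=
  EquivRel cone_rel cone_rel_refl cone_rel_sym cone_rel_trans.

Definition Cone := {eq_quot cone_equiv}.

HB.instance Definition _ := Choice.on Cone.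
HB.instance Definition _ := EqQuotient.on Cone.

Definition cone_class (x : nat -> G) (xP : admissible nu x) : Cone :=
  \pi_Cone (AdmSeq xP).

Definition adm_one : adm_seq nu := AdmSeq (admissible1 nu).
Definition adm_mul x y : adm_seq nu :=
  AdmSeq (admissibleM (adm_funP x) (adm_funP y)).
Definition adm_inv x : adm_seq nu := AdmSeq (admissibleV (adm_funP x)).

(* The operations use chosen representatives; cone_mulE, cone_invE and
   cone_distE show that they do not depend on the choice. *)
Definition cone_one : Cone := \pi_Cone adm_one.
Definition cone_mul (X Y : Cone) : Cone := \pi_Cone (adm_mul (repr X) (repr Y)).
Definition cone_inv (X : Cone) : Cone := \pi_Cone (adm_inv (repr X)).
Definition cone_dist (X Y : Cone) : R :=
  lim (scaled_dist (repr X) (repr Y) @ omega).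

Lemma cone_eqP x y :
  \pi_Cone x = \pi_Cone y <-> scaled_dist x y @ omega --> (0 : R).
Proof. by split=> [/eqmodP/asboolP//|xy]; apply/eqmodP/asboolP. Qed.

Lemma repr_piP x : scaled_dist (repr (\pi_Cone x)) x @ omega --> (0 : R).
Proof. by apply/cone_eqP; rewrite reprK. Qed.

Lemma cone_mulE x y : cone_mul (\pi_Cone x) (\pi_Cone y) = \pi_Cone (adm_mul x y).
Proof.
apply/eqmodP.
apply: (@cone_rel_squeeze _ _ (scaled_dist (repr (\pi_Cone x)) x \+
                               scaled_dist (repr (\pi_Cone y)) y)).
  by move=> n; rewrite /scaled_dist/= -mulrDl ler_wpM2r ?invr_ge0 ?ler0n// norm_distM.
by rewrite -[0 in X in _ --> X](addr0 0); apply: cvgD; exact: repr_piP.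
Qed.

Lemma cone_invE x : cone_inv (\pi_Cone x) = \pi_Cone (adm_inv x).
Proof.
apply/eqmodP; apply: (@cone_rel_squeeze _ _ _ _ (@repr_piP x)) => n.
by rewrite /scaled_dist norm_distV.
Qed.

Lemma adm_seq_eq x y : x =1 y -> x = y.
Proof.
case: x y => [x xP] [y yP] /= /funext xy; subst y.
by rewrite (Prop_irrelevance xP yP).
Qed.

Lemma cone_mulA : associative cone_mul.
Proof.
elim/quotW=> x; elim/quotW=> y; elim/quotW=> z.
rewrite (cone_mulE y z) (cone_mulE x (adm_mul y z)) (cone_mulE x y).
rewrite (cone_mulE (adm_mul x y) z).
by apply: congr1; apply: adm_seq_eq => n /=; rewrite mulgA.
Qed.

Lemma cone_mul1g : left_id cone_one cone_mul.
Proof.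
elim/quotW=> x; rewrite cone_mulE.
by apply: congr1; apply: adm_seq_eq => n /=; rewrite mul1g.
Qed.

Lemma cone_mulg1 : right_id cone_one cone_mul.
Proof.
elim/quotW=> x; rewrite cone_mulE.
by apply: congr1; apply: adm_seq_eq => n /=; rewrite mulg1.
Qed.

Lemma cone_mulVg : left_inverse cone_one cone_inv cone_mul.
Proof.
elim/quotW=> x; rewrite cone_invE (cone_mulE (adm_inv x) x).
by apply: congr1; apply: adm_seq_eq => n /=; rewrite mulVg.
Qed.

Lemma cone_mulgV : right_inverse cone_one cone_inv cone_mul.
Proof.
elim/quotW=> x; rewrite cone_invE (cone_mulE x (adm_inv x)).
by apply: congr1; apply: adm_seq_eq => n /=; rewrite mulgV.
Qed.

HB.instance Definition _ :=
  isGroup.Build Cone cone_mulA cone_mul1g cone_mulg1 cone_mulVg cone_mulgV.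

Lemma cone_distxx X : cone_dist X X = 0.
Proof. by apply/cvg_lim => //; apply/cone_eqP. Qed.

Lemma cone_dist_positivity X Y : cone_dist X Y = 0 -> X = Y.
Proof.
move=> XY; rewrite -[X]reprK -[Y]reprK; apply/cone_eqP.
by rewrite -XY; exact: scaled_dist_cvg.
Qed.

Lemma cone_dist_sym X Y : cone_dist X Y = cone_dist Y X.
Proof. by rewrite /cone_dist scaled_dist_sym. Qed.

Lemma cone_dist_triangle Y X Z : cone_dist X Z <= cone_dist X Y + cone_dist Y Z.
Proof.
rewrite /cone_dist -limD; [|exact: scaled_dist_cvg..].
apply: ler_lim; first exact: scaled_dist_cvg.
  by apply: is_cvgD; exact: scaled_dist_cvg.
by apply: nearW => n; exact: scaled_dist_triangle.
Qed.

HB.instance Definition _ := isMetric.Build R Cone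
  cone_distxx cone_dist_positivity cone_dist_sym cone_dist_triangle.

Lemma cone_distE x y :
  mdist (\pi_Cone x) (\pi_Cone y) = lim (scaled_dist x y @ omega).
Proof.
pose e := scaled_dist (repr (\pi_Cone x)) x \+ scaled_dist (repr (\pi_Cone y)) y.
have e0 : e @ omega --> (0 : R).
  by rewrite -[0 in X in _ --> X](addr0 0); apply: cvgD; exact: repr_piP.
apply/esym/cvg_lim => //.
set X := repr (\pi_Cone x) in e e0 *; set Y := repr (\pi_Cone y) in e e0 *.
have XY := @scaled_dist_cvg X Y; set l := lim _ in XY.
have -> : mdist (\pi_Cone x) (\pi_Cone y) = l by [].
have lo : scaled_dist X Y \- e @ omega --> l.
  by rewrite -[l in X in _ --> X]subr0; exact: cvgB.
have hi : scaled_dist X Y \+ e @ omega --> l.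
  by rewrite -[l in X in _ --> X]addr0; exact: cvgD.
apply: (squeeze_cvgr _ lo hi); apply: nearW => n /=.
have t1 := scaled_dist_triangle x X Y n; have t2 := scaled_dist_triangle y x Y n.
have t3 := scaled_dist_triangle X x y n; have t4 := scaled_dist_triangle Y X y n.
rewrite (scaled_dist_sym y Y) in t2; rewrite (scaled_dist_sym x X) in t3.
rewrite /e /=; apply/andP; split; lra.
Qed.

End Cone.

Arguments Cone {R G} nu omega omegaU.
Arguments cone_class {R G} nu omega omegaU x xP.

(* Main.v *)
(** All the maps involved are coarse Lipschitz: [f] by hypothesis, and [g] because
a conjugation invariant norm is constant on each of the finitely many classes
generating [G].  For the same reason every [y] of [Q] has a preimage of norm at
most [C * nuQ y], which gives surjectivity on cones.  If [g (y n)] has norm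
[o(n)], lift it to such a [z n] of norm [o(n)]; then [y n * (z n)^-1 = f (x n)]
represents the class of [y], and [x] is admissible by the lower quasi-isometry
bound. *)
From HB Require Import structures.
Require Import Defs.
From mathcomp Require Import all_boot all_order all_algebra.
From mathcomp Require Import all_classical all_reals all_analysis.

Set Implicit Arguments.
Unset Strict Implicit.
Unset Printing Implicit Defensive.

Import Order.TTheory GRing.Theory Num.Theory.
Import numFieldNormedType.Exports.

Local Open Scope classical_set_scope.
Local Open Scope ring_scope.

(** * Multiplicative maps and the distance of a norm *)

Lemma multiplicative1 (G K : groupType) (phi : {multiplicative G -> K}) :
  phi 1%g = 1%g.
Proof. by apply: (@mulgI _ (phi 1%g)); rewrite -gmulfM !mulg1. Qed.

Lemma multiplicativeV (G K : groupType) (phi : {multiplicative G -> K}) x :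
  phi x^-1%g = (phi x)^-1%g.
Proof.
by apply: (@mulgI _ (phi x)); rewrite -gmulfM !mulgV multiplicative1.
Qed.

Lemma multiplicative_dist (R : realType) (G K : groupType) (nu : K -> R)
    (phi : {multiplicative G -> K}) x y :
  norm_dist nu (phi x) (phi y) = nu (phi (x * y^-1)%g).
Proof. by rewrite /norm_dist gmulfM multiplicativeV. Qed.

Lemma norm_dist1 (R : realType) (G : groupType) (nu : G -> R) x :
  norm_dist nu x 1%g = nu x.
Proof. by rewrite /norm_dist invg1 mulg1. Qed.

(** * Coarse inequalities divided by n, and their limits along the ultrafilter *)

(** If [omega] contained a singleton {k}, it would lie inside the principal filter at k and equal it
    by maximality. So it contains the complement of every singleton, and finite intersections of
    these give all tails. *)
Lemma nonprincipal_oo (omega : set_system nat) (omegaU : UltraFilter omega) :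
  nonprincipal omega -> omega --> \oo.
Proof.
move=> omega_np.
have omegaC k : omega (~` [set k]).
  have [omegak|//] := in_ultra_setVsetC [set k] omegaU.
  exfalso; apply: (omega_np k); apply/esym.
  apply: max_filter (principal_filter_proper k) _ => A omegaA.
  apply/principal_filterP.
  by have [i [Ai /= <-]] := filter_ex (filterI omegaA omegak).
move=> A [N _ NA]; apply: filterS NA _; elim: N => [|N IH].
  by apply: filterS filterT => n _.
apply: filterS (filterI IH (omegaC N)) => n [/= Nn nN].
by rewrite ltn_neqAle Nn andbT; apply/eqP => /esym.
Qed.

Lemma cvg_divn0 (R : realType) (B : R) (omega : set_system nat)
    (omegaU : UltraFilter omega) (omega_np : nonprincipal omega) :
  B / n%:R @[n --> omega] --> (0 : R).
Proof.
apply: cvg_trans (_ : B / n%:R @[n --> \oo] --> (0 : R)).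
  by apply: cvg_app; exact: nonprincipal_oo.
(* [cvg_harmonic] concerns 1/(n+1), hence the shift. *)
rewrite -cvg_shiftS.
rewrite -[X in _ --> X]/(nbhs (0 : R)) -(mulr0 B).
by apply: cvgM; [exact: cvg_cst|exact: cvg_harmonic].
Qed.

(** This includes n = 0, where all three quotients are 0, so later uses hold for every n. *)
Lemma coarse_ratio (R : realType) (A B u v : R) (n : nat) :
  u <= A * v + B -> u / n%:R <= A * (v / n%:R) + B / n%:R.
Proof. by move=> uv; rewrite mulrA -mulrDl ler_wpM2r ?invr_ge0 ?ler0n. Qed.

(** Rescaling kills the additive constant and keeps only the multiplicative one. *)
Lemma cvg_coarse_ratio (R : realType) (A B l : R) (v : nat -> R)
    (omega : set_system nat) (omegaU : UltraFilter omega)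
    (omega_np : nonprincipal omega) :
  v n / n%:R @[n --> omega] --> l ->
  A * (v n / n%:R) + B / n%:R @[n --> omega] --> A * l.
Proof.
move=> vl; have Bn0 := @cvg_divn0 _ B _ omegaU omega_np.
by rewrite -[A * l]addr0; apply: cvgD Bn0; apply: cvgM => //; exact: cvg_cst.
Qed.

Lemma coarse_ratio_cvg0 (R : realType) (A B : R) (u v : nat -> R)
    (omega : set_system nat) (omegaU : UltraFilter omega)
    (omega_np : nonprincipal omega) :
  (forall n, 0 <= u n) -> (forall n, u n <= A * v n + B) ->
  v n / n%:R @[n --> omega] --> (0 : R) ->
  u n / n%:R @[n --> omega] --> (0 : R).
Proof.
move=> u0 uv /(@cvg_coarse_ratio _ A B _ _ _ omegaU omega_np).
rewrite mulr0 => w0.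
apply: (squeeze_cvgr _ (cvg_cst (0 : R)) w0); apply: nearW => n.
by rewrite divr_ge0//= coarse_ratio.
Qed.

Lemma admissible_coarse (R : realType) (G K : groupType) (nuG : G -> R)
    (nuK : K -> R) (A B : R) (x : nat -> G) (y : nat -> K) :
  0 <= A -> 0 <= B -> (forall n, nuK (y n) <= A * nuG (x n) + B) ->
  admissible nuG x -> admissible nuK y.
Proof.
move=> A0 B0 yx [C xC]; exists (A * C + B) => n n0.
rewrite (le_trans (coarse_ratio n (yx n)))// lerD ?ler_wpM2l ?xC//.
(* B / n <= B because n >= 1 and B >= 0. *)
by rewrite ler_pdivrMr ?ltr0n// ler_peMr// ler1n.
Qed.

(** * Linear norm bounds from finitely many conjugacy classes *)

(* Applied to the graph of [g] (giving that [g] is Lipschitz) and to its converse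
   (giving preimages of controlled norm). *)
Lemma word_norm_transfer (R : realType) (G K : groupType)
    (nuG : G -> R) (nuK : conj_norm R K) (S : G -> K -> Prop) :
  fin_conj_word_norm nuG ->
  (forall x, exists y, S x y) -> S 1%g 1%g ->
  (forall x x' y y', S x y -> S x' y' -> S (x * x')%g (y * y')%g) ->
  (forall x y, S x y -> S x^-1%g y^-1%g) ->
  exists2 C : R, 0 <= C & forall x, exists2 y, S x y & nuK y <= C * nuG x.
Proof.
move=> [T [[A finA TE] _ _ wordT]] Stot S1 SM SV.
have nuKP := conj_normP nuK; have nuK0 := gnorm_ge0 nuKP.
have [r rS] := choice Stot.
have /finite_seqP[s As] := finA.
(* The sum of nonnegative terms bounds each [nuK (r a)] at once. *)
pose C := \sum_(a <- s) nuK (r a).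
(* A generator h a h^-1 is related to the conjugate of [r a] by [r h], whose norm is that of [r a]
   whatever h is; this makes the bound uniform over infinite classes. *)
have TC t : T t -> exists2 z, S t z & nuK z <= C.
  rewrite TE => -[a Aa [h _ <-]]; exists (r h * r a * (r h)^-1)%g.
    by apply: (SM) (SV _ _ _) => //; exact: SM.
  rewrite (conj_normJ nuK); move: Aa; rewrite As /= => sa.
  rewrite /C (big_rem a)//= lerDl; exact: sumr_ge0.
exists C; first exact: sumr_ge0.
(* Take a word for x of length exactly [nuG x]; each letter costs at most [C]. *)
move=> x; have [_ [-> [w [<- wT ->]] _]] := wordT x.
elim: w wT => [|t w IH] wT.
  by exists 1%g; rewrite ?big_nil// gnorm1 mulr0.
have [|y Sy yC] := IH; first by move=> u uw; apply: wT; rewrite inE uw orbT.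
have [|z Sz zC] := TC t; first by apply: wT; rewrite inE eqxx.
exists (z * y)%g; first by rewrite big_cons; exact: SM.
by rewrite (le_trans (gnormM nuKP _ _))//= -natr1 mulrDr mulr1 addrC lerD.
Qed.

(** * Homomorphisms induced on cones *)

Lemma cone_classP (R : realType) (G : groupType) (nu : conj_norm R G)
    (omega : set_system nat) (omegaU : UltraFilter omega)
    (x y : nat -> G) (xP : admissible nu x) (yP : admissible nu y) :
  cone_class nu omega omegaU x xP = cone_class nu omega omegaU y yP <->
  norm_dist nu (x n) (y n) / n%:R @[n --> omega] --> (0 : R).
Proof. exact: cone_eqP. Qed.

Lemma cone_class_ind (R : realType) (G : groupType) (nu : conj_norm R G)
    (omega : set_system nat) (omegaU : UltraFilter omega)
    (P : Cone nu omega omegaU -> Prop) :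
  (forall x xP, P (cone_class nu omega omegaU x xP)) -> forall X, P X.
Proof. by move=> Pc; elim/quotW => -[x xP]; exact: Pc. Qed.

Lemma cone_class1 (R : realType) (G : groupType) (nu : conj_norm R G)
    (omega : set_system nat) (omegaU : UltraFilter omega) :
  cone_class nu omega omegaU (fun=> 1%g) (admissible1 nu) = 1%g.
Proof. by []. Qed.

(** By multiplicativity the bound on norms is also a bound on distances. After division by n the
    term B disappears in the limit, so termwise application descends to classes and is Lipschitz
    with constant A. *)
Lemma cone_hom (R : realType) (G K : groupType)
    (nuG : conj_norm R G) (nuK : conj_norm R K)
    (phi : {multiplicative G -> K}) (A B : R)
    (omega : set_system nat) (omegaU : UltraFilter omega) :
  nonprincipal omega -> 0 <= A -> 0 <= B ->
  (forall x, nuK (phi x) <= A * nuG x + B) ->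
  exists phihat : {multiplicative Cone nuG omega omegaU -> Cone nuK omega omegaU},
    (forall x (xP : admissible nuG x),
       exists pxP : admissible nuK (fun n => phi (x n)),
         phihat (cone_class nuG omega omegaU x xP) =
         cone_class nuK omega omegaU (fun n => phi (x n)) pxP) /\
    continuous phihat.
Proof.
move=> omega_np A0 B0 phiAB.
have phi_adm x : admissible nuG x -> admissible nuK (fun n => phi (x n)).
  exact: (admissible_coarse A0 B0 (fun n => phiAB (x n))).
(* Defined through a chosen representative; [FE] shows that any other gives the same class. *)
pose F (X : Cone nuG omega omegaU) : Cone nuK omega omegaU :=
  cone_class nuK omega omegaU _ (phi_adm _ (adm_funP (repr X))).
have distAB (x y : nat -> G) n :
    norm_dist nuK (phi (x n)) (phi (y n)) <= A * norm_dist nuG (x n) (y n) + B.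
  by rewrite multiplicative_dist; exact: phiAB.
have FE x (xP : admissible nuG x) : F (cone_class nuG omega omegaU x xP) =
    cone_class nuK omega omegaU (fun n => phi (x n)) (phi_adm _ xP).
  rewrite /F; set r := repr _; apply/cone_classP.
  apply: (coarse_ratio_cvg0 omegaU omega_np _ (distAB r x)).
    by move=> n; exact: norm_dist_ge0.
  exact: (@repr_piP _ _ _ _ omegaU (AdmSeq xP)).
have FM : {morph F : X Y / (X * Y)%g}.
  elim/cone_class_ind => x xP; elim/cone_class_ind => y yP.
  transitivity (F (cone_class nuG omega omegaU _ (admissibleM xP yP))).
    by congr F; exact: cone_mulE.
  rewrite (FE _ xP) (FE _ yP) FE; apply: etrans (esym (cone_mulE _ _ _)).
  congr (\pi_(Cone nuK omega omegaU)%qT _).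
  by apply: adm_seq_eq => n /=; rewrite gmulfM.
have Flip X Y : mdist (F X) (F Y) <= A * mdist X Y.
  move: X Y; elim/cone_class_ind => x xP; elim/cone_class_ind => y yP.
  rewrite !FE !cone_distE.
  have xy := @scaled_dist_cvg _ _ _ _ omegaU (AdmSeq xP) (AdmSeq yP).
  have {}xy := @cvg_coarse_ratio _ A B _ _ _ omegaU omega_np xy.
  rewrite -(cvg_lim _ xy)//; apply: ler_lim; first exact: scaled_dist_cvg.
    exact: cvgP xy.
  by apply: nearW => n; exact: coarse_ratio (distAB x y n).
pose hom := isMultiplicative.Build _ _ F FM.
pose Fhat : {multiplicative Cone nuG omega omegaU -> Cone nuK omega omegaU} :=
  HB.pack F hom.
exists Fhat; split=> [x xP|X]; first by exists (phi_adm _ xP); exact: FE.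
apply/(@metricType_numDomainType.cvgrPdist_lt _ _ _ _ (nbhs_filter X)) => e e0.
(* A may be 0, so the radius is e / (A + 1) rather than e / A. *)
have A1 : 0 < A + 1 by rewrite ltr_wpDl.
have : \forall Y \near X, mdist X Y < e / (A + 1).
  apply: (@metricType_numDomainType.cvgr_dist_lt _ _ _ _ (nbhs_filter X) id).
    by [].
  by rewrite divr_gt0.
apply: filterS => Y; rewrite ltr_pdivlMr// mulrC; apply: le_lt_trans.
apply: (le_trans (Flip X Y)).
by rewrite ler_wpM2r ?lerDl ?mdist_ge0.
Qed.

(** * Exactness of the sequence of cones *)

Theorem lemma3p3 (R : realType) (H G Q : groupType)
    (f : {multiplicative H -> G}) (g : {multiplicative G -> Q})
    (fg_exact : short_exact f g)
    (nuH : conj_norm R H) (nuG : conj_norm R G) (nuQ : conj_norm R Q)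
    (nuG_word : fin_conj_word_norm nuG) (nuQ_word : fin_conj_word_norm nuQ)
    (omega : set_system nat) (omegaU : UltraFilter omega)
    (omega_np : nonprincipal omega)
    (f_qi : quasi_isometric_embedding (norm_dist nuH) (norm_dist nuG) f) :
  exists (fhat : {multiplicative Cone nuH omega omegaU -> Cone nuG omega omegaU})
         (ghat : {multiplicative Cone nuG omega omegaU -> Cone nuQ omega omegaU}),
    [/\ forall (x : nat -> H) (xP : admissible nuH x),
          exists fxP : admissible nuG (fun n => f (x n)),
            fhat (cone_class nuH omega omegaU x xP) =
            cone_class nuG omega omegaU (fun n => f (x n)) fxP,
        forall (x : nat -> G) (xP : admissible nuG x),
          exists gxP : admissible nuQ (fun n => g (x n)),
            ghat (cone_class nuG omega omegaU x xP) =
            cone_class nuQ omega omegaU (fun n => g (x n)) gxP,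
        continuous fhat,
        continuous ghat &
        short_exact fhat ghat].
Proof.
have [f_inj f_range g_surj] := fg_exact.
have kerg x : g x = 1%g -> exists h, f h = x.
  by move=> gx; have [h _ <-] : range f x; [rewrite f_range|exists h].
have gf h : g (f h) = 1%g.
  by have : range f (f h); [exists h|rewrite f_range].
have [A [B [A1 B0 AB]]] := f_qi.
have A0 : 0 < A by exact: lt_le_trans ltr01 A1.
have f_up h : nuG (f h) <= A * nuH h + B.
  by have [_] := AB h 1%g; rewrite multiplicative_dist invg1 mulg1 norm_dist1.
(* The lower quasi-isometry bound multiplied by A, which has the shape of the coarse lemmas with [f]
   reversed. *)
have f_low h k :
    norm_dist nuH h k <= A * norm_dist nuG (f h) (f k) + A * B.
  by have [+ _] := AB h k; rewrite lerBlDr ler_pdivrMl// mulrDr.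
have [L L0 gL] : exists2 L : R, 0 <= L & forall x, nuQ (g x) <= L * nuG x.
  have [||||L L0 gL] :=
    @word_norm_transfer _ _ _ _ nuQ (fun x y => g x = y) nuG_word.
  - by move=> x; exists (g x).
  - exact: multiplicative1.
  - by move=> x x' y y' <- <-; rewrite gmulfM.
  - by move=> x y <-; rewrite multiplicativeV.
  - by exists L => // x; have [_ <-] := gL x.
have [M M0 lift] :
    exists2 M : R, 0 <= M & forall q, exists2 x, g x = q & nuG x <= M * nuQ q.
  apply: (@word_norm_transfer _ _ _ _ nuG (fun q x => g x = q) nuQ_word).
  - by move=> q; have [x _ <-] : range g q; [rewrite g_surj|exists x].
  - exact: multiplicative1.
  - by move=> x x' y y' <- <-; rewrite gmulfM.
  - by move=> x y <-; rewrite multiplicativeV.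
have [fhat [fhatE fhatC]] := cone_hom omegaU omega_np (ltW A0) B0 f_up.
have [||ghat [ghatE ghatC]] :=
  @cone_hom _ _ _ nuG nuQ g L 0 _ omegaU omega_np L0.
- by [].
- by move=> x; rewrite addr0.
(* Termwise lifting with linear control; the [+ 0] fits the coarse lemmas with B = 0. *)
have liftP (q : nat -> Q) : admissible nuQ q ->
    exists z : nat -> G, [/\ admissible nuG z, forall n, g (z n) = q n &
      forall n, nuG (z n) <= M * nuQ (q n) + 0].
  move=> qP.
  have /choice[z zP] : forall n,
      exists x, g x = q n /\ nuG x <= M * nuQ (q n) + 0.
    by move=> n; have [x ? ?] := lift (q n); exists x; rewrite addr0.
  exists z; split=> [|n|n]; [|by have [] := zP n|by have [] := zP n].
  by apply: (admissible_coarse M0 (lexx 0) _ qP) => n; have [] := zP n.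
exists fhat, ghat; split => //; split.
(* Injectivity: by [f_low], sequences whose images are at sublinear distance are themselves so. *)
- elim/cone_class_ind => x xP; elim/cone_class_ind => y yP.
  have [fxP ->] := fhatE x xP; have [fyP ->] := fhatE y yP.
  move=> /cone_classP fxy; apply/cone_classP.
  apply: (coarse_ratio_cvg0 omegaU omega_np _ _ fxy) => n; last exact: f_low.
  exact: norm_dist_ge0.
- apply/seteqP; split=> [_ [X _ <-]/=|Y/=].
    move: X; elim/cone_class_ind => x xP.
    have [fxP ->] := fhatE x xP; have [gfxP ->] := ghatE _ fxP.
    rewrite -cone_class1; apply/cone_classP.
    under eq_fun do rewrite gf norm_distxx mul0r.
    exact: cvg_cst.
  (* Kernel inside image: correct y by a small lift z of g y, so that the quotient lands termwise in
     the range of [f]. *)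
  move: Y; elim/cone_class_ind => y yP; have [gyP ->] := ghatE y yP.
  rewrite -cone_class1 => /cone_classP gy0.
  have [z [zP gz zM]] := liftP _ gyP.
  have /choice[x fx] : forall n, exists h, f h = (y n * (z n)^-1)%g.
    move=> n; apply: kerg.
    by rewrite gmulfM multiplicativeV gz mulgV.
  have xP : admissible nuH x.
    apply: (@admissible_coarse _ _ _ nuG nuH A (A * B) _ x (ltW A0) _ _
      (admissibleM yP (admissibleV zP))); first by rewrite mulr_ge0// ltW.
    move=> n; rewrite -fx -norm_dist1 (le_trans (f_low _ _))//.
    by rewrite multiplicative1 norm_dist1.
  exists (cone_class nuH omega omegaU x xP) => //.
  have [fxP ->] := fhatE x xP; apply/cone_classP.
  (* Here f(x n) (y n)^-1 = y n (z n)^-1 (y n)^-1 has the norm of z n, by invariance under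
     conjugation and inversion, and this is at most M times the norm of g(y n). *)
  apply: (@coarse_ratio_cvg0 _ M 0 _ (fun n => norm_dist nuQ (g (y n)) 1%g)
    _ omegaU omega_np _ _ gy0) => n; first exact: norm_dist_ge0.
  rewrite norm_dist1; apply: le_trans (zM n).
  by rewrite /norm_dist fx (conj_normJ nuG) (gnormV (conj_normP nuG)).
- apply/seteqP; split=> // Y _; move: Y; elim/cone_class_ind => q qP.
  have [z [zP gz _]] := liftP _ qP.
  exists (cone_class nuG omega omegaU z zP) => //.
  have [gzP ->] := ghatE z zP; apply/cone_classP.
  under eq_fun do rewrite gz norm_distxx mul0r.
  exact: cvg_cst.
Qed.
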